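(* Let $\mathbb{F}$ be an algebraically closed field of characteristic zero. For all integers $d> k\ge 2$ there is a constant $B_{d,k}$ depending only on $d$ and $k$ such that for all $n,m\ge1$ and every nonzero linear map $\phi:P(n,d)\to\mathrm{Ten}(m,k)$ (a $T_k$-rank method, with simples $S=\{\ell^d:\ell\in P(n,1)\}$), $$\mathrm{Pot}(\phi)\le B_{d,k}\cdot n^{\lfloor (k-1)d/k\rfloor}.$$
   Context: $P(n,d)$ is the space of homogeneous polynomials of degree $d$ in $n$ variables over $\mathbb F$; $\mathrm{Ten}(m,k)=(\mathbb F^m)^{\otimes k}$. The tensor rank $\mathrm{trk}(T)$ is the least $r$ such that $T$ is a sum of $r$ tensors of the form $\mathbf v_1\otimes\cdots\otimes\mathbf v_k$. For a linear map $\phi:V\to\mathrm{Ten}(m,k)$ and a spanning set $S\subseteq V$, set $\mu_\phi(v)=\mathrm{trk}(\phi(v))$, $\mu_\phi(X)=\max_{x\in X}\mu_\phi(x)$, and $\mathrm{Pot}(\phi)=\mu_\phi(V)/\mu_\phi(S)$. *)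

(* Defs.v *)
From HB Require Import structures.
From mathcomp Require Import all_boot all_order all_algebra.
From Stdlib Require Import ClassicalEpsilon.
Set Implicit Arguments. Unset Strict Implicit. Unset Printing Implicit Defensive.
Import Order.TTheory GRing.Theory Num.Theory.
Local Open Scope ring_scope.

Definition monom (n d : nat) :=
  {a : {ffun 'I_n -> 'I_d.+1} | (\sum_(i < n) (a i : nat) == d)%N}.

(* P(n,d): homogeneous polynomials of degree d in n variables over F,
   represented by their coefficient vector in the monomial basis. *)
Notation Pol F n d := {ffun monom n d -> (GRing.Field.sort F)^o}.

(* Ten(m,k) = (F^m)^{(x) k}: functions on k-tuples of indices in 'I_m. *)
Notation Ten F m k := {ffun {ffun 'I_k -> 'I_m} -> (GRing.Field.sort F)^o}.

Definition multinom (n d : nat) (a : monom n d) : nat :=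
  (d`! %/ \prod_(i < n) (val a i : nat)`!)%N.

(* ell^d for the linear form ell = sum_i c_i x_i  (c in F^n = P(n,1)) *)
Definition lin_pow (F : fieldType) (n d : nat) (c : 'I_n -> F) : Pol F n d :=
  [ffun a : monom n d => (multinom a)%:R * \prod_(i < n) c i ^+ (val a i : nat)].

Definition pure_tensor (F : fieldType) (m k : nat) (v : 'I_k -> 'I_m -> F)
  : Ten F m k := [ffun idx : {ffun 'I_k -> 'I_m} => \prod_(t < k) v t (idx t)].

Definition sum_of_pure (F : fieldType) (m k : nat) (T : Ten F m k) (r : nat) : Prop :=
  exists v : 'I_r -> 'I_k -> 'I_m -> F, T = \sum_(j < r) pure_tensor (v j).

Definition trk (F : fieldType) (m k : nat) (T : Ten F m k) : nat :=
  epsilon (inhabits 0%N)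
    (fun r => sum_of_pure T r /\ forall r', sum_of_pure T r' -> (r <= r')%N).

(* mu_phi(X) = max_{x in X} trk(phi x), for X given as the image of g : I -> V *)
Definition mu_max (I V : Type) (F : fieldType) (m k : nat)
  (phi : V -> Ten F m k) (g : I -> V) : nat :=
  epsilon (inhabits 0%N)
    (fun M => (exists x, trk (phi (g x)) = M) /\ forall x, (trk (phi (g x)) <= M)%N).

Definition Pot (F : fieldType) (n d m k : nat) (phi : Pol F n d -> Ten F m k) : rat :=
  ((mu_max phi (@id (Pol F n d)))%:R / (mu_max phi (@lin_pow F n d))%:R)%R.

(* Main.v *)
Require Import Defs.
From HB Require Import structures.
From mathcomp Require Import all_boot all_order all_algebra.
From mathcomp Require Import boolp classical_sets functions filter.
From mathcomp Require Import ring zify.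
Set Implicit Arguments.
Unset Strict Implicit.
Unset Printing Implicit Defensive.
Import Order.TTheory GRing.Theory Num.Theory.
Local Open Scope ring_scope.

(** Let r bound the rank of phi(l^d) for all linear forms l. As a function of
    the coefficients of l, phi(l^d) is a tensor T(x) of forms of degree d in
    x_1, ..., x_n. Passing to an iterated ultrapower K of F, the bound still
    holds at a point x of K^n with algebraically independent coordinates, so
    T(x) is a sum of r pure tensors over K, and there are derivations D_i of K
    over F with D_i x_j = delta_ij (they need not commute). Up to nonzero
    scalars the coefficients of T are its images under words of length d in the
    D_i. By Leibniz, such a word w maps v_1 (x) ... (x) v_k to the sum, over all
    s : [d] -> [k], of the tensors (D_{w|s=1} v_1) (x) ... (x) (D_{w|s=k} v_k).
    Given s, some t is hit at least d/k times; the terms whose words agree off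
    s^-1(t) differ only in factor t, hence add up to one pure tensor. So any
    combination of the coefficients of T has rank at most
    r * k^d * n^((k-1)d/k) over K, and then over F, because an identity between
    finitely many elements of an ultrapower holds at some index. *)

(** * Ultrapowers *)

(** Refining the filter of tails makes the ultrafilter non-principal; this is what will make
    [ultra_id] transcendental. *)
Definition ultra : set_system nat :=
  sval (cid (ultraFilterLemma eventually_filter)).

Lemma ultraP : UltraFilter ultra.
Proof. by rewrite /ultra; case: cid => G []. Qed.
#[local] Existing Instance ultraP.

Lemma ultra_ge (N : nat) : ultra (fun i => N <= i)%N.
Proof. by rewrite /ultra; case: cid => G [_ /= sG]; apply: sG; exists N. Qed.

Definition ultra_null (K : fieldType) : pred (nat -> K) :=
  fun f => `[< ultra (fun i => f i = 0) >].

Lemma ultra_null_idealr (K : fieldType) : idealr_closed (@ultra_null K).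
Proof.
split.
- by apply/asboolP; apply: filterS filterT.
- apply/negP => /asboolP /filter_ex[i] /= /eqP.
  by rewrite oner_eq0.
- move=> a f g /asboolP Uf /asboolP Ug; apply/asboolP.
  apply: filterS (filterI Uf Ug) => i [/= fi gi].
  by rewrite /GRing.add /= /GRing.mul /= fi gi mulr0 addr0.
Qed.

HB.instance Definition _ (K : fieldType) :=
  isIdealr.Build (nat -> K) (@ultra_null K) (@ultra_null_idealr K).

Definition ultra_ideal (K : fieldType) : idealr (nat -> K) := @ultra_null K.

Definition ultrapower (K : fieldType) := {ideal_quot (ultra_ideal K)}.

HB.instance Definition _ (K : fieldType) := GRing.ComNzRing.on (ultrapower K).

Definition ultra_class (K : fieldType) (f : nat -> K) : ultrapower K :=
  \pi_{ideal_quot (ultra_ideal K)}%qT f.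

Lemma ultra_classP (K : fieldType) (f g : nat -> K) :
  ultra_class f = ultra_class g <-> ultra (fun i => f i = g i).
Proof.
have -> : ultra (fun i => f i = g i) = (f - g \in @ultra_null K).
  apply/propext; split=> [h|/asboolP h]; [apply/asboolP|];
  by apply: filterS h => i /= /eqP fg; apply/eqP; move: fg; rewrite subr_eq0.
by rewrite Quotient.idealrBE; split=> [h|/eqP //]; apply/eqP.
Qed.

Lemma ultra_class_zmod (K : fieldType) : zmod_morphism (@ultra_class K).
Proof. exact: raddfB. Qed.

Lemma ultra_class_monoid (K : fieldType) : monoid_morphism (@ultra_class K).
Proof. by split; [exact: rmorph1 | exact: rmorphM]. Qed.

HB.instance Definition _ (K : fieldType) :=
  GRing.isZmodMorphism.Build (nat -> K) (ultrapower K) (@ultra_class K)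
    (@ultra_class_zmod K).
HB.instance Definition _ (K : fieldType) :=
  GRing.isMonoidMorphism.Build (nat -> K) (ultrapower K) (@ultra_class K)
    (@ultra_class_monoid K).

Definition ultra_repr (K : fieldType) (u : ultrapower K) : nat -> K := repr u.

Lemma ultra_reprK (K : fieldType) (u : ultrapower K) :
  ultra_class (ultra_repr u) = u.
Proof. exact: reprK. Qed.

Definition ultra_inv (K : fieldType) (u : ultrapower K) : ultrapower K :=
  ultra_class (fun i => (ultra_repr u i)^-1).

Lemma ultra_mulVf (K : fieldType) (u : ultrapower K) :
  u != 0 -> ultra_inv u * u = 1.
Proof.
move=> u0; rewrite -[u in _ * u]ultra_reprK -rmorphM -(rmorph1 (@ultra_class K)).
apply/ultra_classP.
(* The ultrafilter decides: the representative vanishes on a large set, or is non-zero on a large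
   set, where the inverse taken index by index works. *)
case: (in_ultra_setVsetC (fun i => ultra_repr u i = 0) ultraP) => h.
  case/eqP: u0; rewrite -[u]ultra_reprK -(rmorph0 (@ultra_class K)).
  exact/ultra_classP.
by apply: filterS h => i /= /eqP ui; rewrite -[LHS]/(_ * _) mulVf.
Qed.

Lemma ultra_inv0 (K : fieldType) : @ultra_inv K 0 = 0.
Proof.
have : @ultra_class K (ultra_repr 0) = ultra_class 0.
  by rewrite ultra_reprK rmorph0.
move/ultra_classP => U0; rewrite -[RHS](rmorph0 (@ultra_class K)).
apply/ultra_classP; apply: filterS U0 => i e.
exact: etrans (congr1 GRing.inv e) (invr0 _).
Qed.

HB.instance Definition _ (K : fieldType) :=
  GRing.ComNzRing_isField.Build (ultrapower K) (@ultra_mulVf K) (@ultra_inv0 K).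

Definition ultra_const (K : fieldType) (c : K) : ultrapower K :=
  ultra_class (fun=> c).

Lemma ultra_const_zmod (K : fieldType) : zmod_morphism (@ultra_const K).
Proof. by move=> a b; rewrite /ultra_const -rmorphB. Qed.

Lemma ultra_const_monoid (K : fieldType) : monoid_morphism (@ultra_const K).
Proof.
split; first exact: (rmorph1 (@ultra_class K)).
by move=> a b; rewrite /ultra_const -rmorphM.
Qed.

HB.instance Definition _ (K : fieldType) :=
  GRing.isZmodMorphism.Build K (ultrapower K) (@ultra_const K)
    (@ultra_const_zmod K).
HB.instance Definition _ (K : fieldType) :=
  GRing.isMonoidMorphism.Build K (ultrapower K) (@ultra_const K)
    (@ultra_const_monoid K).

Definition ultra_id (K : fieldType) : ultrapower K :=
  ultra_class (fun i => i%:R).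

Lemma ultra_horner (K : fieldType) (p : {poly K}) (f : nat -> K) :
  (map_poly (@ultra_const K) p).[ultra_class f] =
  ultra_class (fun i => p.[f i]).
Proof.
elim/poly_ind: p => [|p c IH].
  rewrite rmorph0 horner0 -(rmorph0 (@ultra_class K)); congr ultra_class.
  by apply/funext => i; rewrite horner0.
rewrite rmorphD rmorphM /= map_polyX map_polyC !hornerE IH -rmorphM -rmorphD.
congr ultra_class; apply/funext => i.
by rewrite !hornerE.
Qed.

(** Finitely many roots leave a tail of naturals free of roots, as naturals stay distinct in
    characteristic 0. The induction, on a bound for the size, divides off a natural root [j]; beyond
    [j] the factor [i - j] is non-zero. *)
Lemma natr_nonroot (K : fieldType) (p : {poly K}) :
  [pchar K] =i pred0 -> p != 0 ->
  exists N, forall i : nat, (N <= i)%N -> p.[i%:R] != 0.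
Proof.
move=> charK; move: {2}(size p) (leqnn (size p)) => s.
elim: s p => [|s IH] p; first by rewrite leqn0 size_poly_eq0 => /eqP -> /eqP.
move=> sp p0; case: (pselect (exists j : nat, p.[j%:R] == 0)) => [[j]|nroot].
  rewrite -/(root p _) => /factor_theorem[q pE].
  have q0 : q != 0 by apply: contraNneq p0 => q0; rewrite pE q0 mul0r.
  have [|N hN] := IH q _ q0.
    by move: sp; rewrite pE size_Mmonic ?monicXsubC// size_XsubC addn2.
  exists (maxn N j.+1) => i; rewrite geq_max => /andP[Ni ji].
  rewrite pE hornerM mulf_neq0 ?hN // hornerXsubC -natrB ?(ltnW ji) //.
  by rewrite ((pcharf0P K).1 charK) subn_eq0 -ltnNge.
by exists 0 => i _; apply/negP => pi; apply: nroot; exists i.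
Qed.

(** A zero at [ultra_id] means that [p] vanishes on a large set of naturals, and such a set meets
    every tail. *)
Lemma ultra_id_transcendental (K : fieldType) (p : {poly K}) :
  [pchar K] =i pred0 ->
  (map_poly (@ultra_const K) p).[ultra_id K] = 0 -> p = 0.
Proof.
move=> charK; rewrite ultra_horner -(rmorph0 (@ultra_class K)).
move=> /ultra_classP Up; apply/eqP/negPn/negP => p0.
have [N rN] := natr_nonroot charK p0.
have [i /= [Ni pi]] := filter_ex (filterI (ultra_ge N) Up).
by move/eqP: (rN i Ni); rewrite pi.
Qed.

(** * Derivations *)

Definition derivation (K : fieldType) (D : K -> K) : Prop :=
  (forall a b, D (a + b) = D a + D b) /\
  (forall a b, D (a * b) = D a * b + a * D b).

Lemma derivation0 (K : fieldType) (D : K -> K) : derivation D -> D 0 = 0.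
Proof. by case=> DD _; apply: (addrI (D 0)); rewrite -DD !addr0. Qed.

Lemma derivation1 (K : fieldType) (D : K -> K) : derivation D -> D 1 = 0.
Proof.
case=> _ DM; apply: (addrI (D 1)).
by rewrite addr0 -[RHS](congr1 D (mulr1 1)) DM mulr1 mul1r.
Qed.

Lemma derivation_nat (K : fieldType) (D : K -> K) e :
  derivation D -> D e%:R = 0.
Proof.
move=> DD; elim: e => [|e IH]; first exact: derivation0.
by rewrite mulrS (proj1 DD) IH derivation1 // addr0.
Qed.

Lemma derivation_sum (K : fieldType) (D : K -> K) (I : Type) (r : seq I)
    (P : pred I) (g : I -> K) :
  derivation D -> D (\sum_(i <- r | P i) g i) = \sum_(i <- r | P i) D (g i).
Proof. by move=> DD; apply: big_morph; [case: DD|exact: derivation0]. Qed.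

Lemma derivation_prod (K : fieldType) (D : K -> K) k (g : 'I_k -> K) :
  derivation D ->
  D (\prod_t g t) = \sum_s \prod_t (if t == s then D (g t) else g t).
Proof.
move=> DD; elim: k g => [|k IH] g.
  by rewrite !big_ord0 derivation1.
rewrite big_ord_recl (proj2 DD) IH [RHS]big_ord_recl; congr (_ + _).
  by rewrite [RHS]big_ord_recl eqxx; congr (_ * _).
rewrite mulr_sumr; apply: eq_bigr => s _.
rewrite [RHS]big_ord_recl /=; congr (_ * _).
Qed.

Lemma derivationX (K : fieldType) (D : K -> K) a e :
  derivation D -> D (a ^+ e) = e%:R * a ^+ e.-1 * D a.
Proof.
move=> DD; elim: e => [|e IH]; first by rewrite expr0 derivation1 // !mul0r.
rewrite exprS (proj2 DD) IH /=; case: e {IH} => [|e] /=; first by rewrite expr0; ring.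
by rewrite !mulrS !exprS; ring.
Qed.

(* A derivation on a subring of L, given by its graph: this is a subring of
   the dual numbers L[e] (a pair (a, b) standing for a + b e) that meets L e
   trivially. *)
Definition derivation_graph (L : fieldType) (G : set (L * L)) : Prop :=
  [/\ G (1, 0),
      forall u v, G u -> G v -> G (u.1 - v.1, u.2 - v.2),
      forall u v, G u -> G v -> G (u.1 * v.1, u.2 * v.1 + u.1 * v.2)
    & forall b, G (0, b) -> b = 0].

Section Graph.
Variables (L : fieldType) (G : set (L * L)).
Hypothesis GG : derivation_graph G.

Lemma graph0 : G (0, 0).
Proof. by case: GG => g1 gB _ _; have := gB _ _ g1 g1; rewrite /= !subrr. Qed.

Lemma graphN u : G u -> G (- u.1, - u.2).
Proof.
by move=> gu; case: GG => _ gB _ _; have := gB _ _ graph0 gu; rewrite /= !sub0r.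
Qed.

Lemma graphD u v : G u -> G v -> G (u.1 + v.1, u.2 + v.2).
Proof.
move=> gu gv; case: GG => _ gB _ _.
by have := gB _ _ gu (graphN gv); rewrite /= !opprK.
Qed.

Lemma graph_sum (I : Type) (r : seq I) (P : pred I) (f g : I -> L) :
  (forall i, P i -> G (f i, g i)) ->
  G (\sum_(i <- r | P i) f i, \sum_(i <- r | P i) g i).
Proof.
move=> fg; elim: r => [|i r IH]; first by rewrite !big_nil; apply: graph0.
by rewrite !big_cons; case: ifP => // /fg gi; exact: (graphD gi IH).
Qed.

Lemma graph_fun a b c : G (a, b) -> G (a, c) -> b = c.
Proof.
case: GG => _ gB _ g0 ab ac; have := gB _ _ ab ac.
by rewrite /= subrr => /g0/eqP; rewrite subr_eq0 => /eqP.
Qed.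

(* (p, q) stands for the polynomial p + q e over the dual numbers. *)
Definition poly_graph (p q : {poly L}) := forall i, G (p`_i, q`_i).

Lemma poly_graphB p1 q1 p2 q2 :
  poly_graph p1 q1 -> poly_graph p2 q2 -> poly_graph (p1 - p2) (q1 - q2).
Proof.
move=> h1 h2 i; case: GG => _ gB _ _; rewrite !coefB.
exact: (gB _ _ (h1 i) (h2 i)).
Qed.

Lemma poly_graphM p1 q1 p2 q2 :
  poly_graph p1 q1 -> poly_graph p2 q2 ->
  poly_graph (p1 * p2) (q1 * p2 + p1 * q2).
Proof.
move=> h1 h2 i; case: GG => _ _ gM _; rewrite coefD !coefM -big_split /=.
by apply: graph_sum => j _; exact: (gM _ _ (h1 j) (h2 _)).
Qed.

Lemma poly_graphXn k : poly_graph 'X^k 0.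
Proof.
case: GG => g1 _ _ _ i; rewrite coefXn coef0.
by case: (i == k) => //; exact: graph0.
Qed.

Lemma poly_graphC c d : G (c, d) -> poly_graph c%:P d%:P.
Proof.
by move=> cd i; rewrite !coefC; case: (i == 0%N) => //; exact: graph0.
Qed.

Lemma poly_graph_deriv p q : poly_graph p q -> poly_graph p^`() q^`().
Proof.
move=> h i; rewrite !coef_deriv.
suff gn n : G (p`_i.+1 *+ n, q`_i.+1 *+ n) by exact: gn.
elim: n => [|n IH]; first by rewrite !mulr0n; exact: graph0.
by rewrite !mulrS; exact: (graphD (h _) IH).
Qed.

(* The e-part of the value of p + q e at the dual number a + b e. *)
Definition tangent (a b : L) (p q : {poly L}) := q.[a] + p^`().[a] * b.

Lemma tangentB a b p1 q1 p2 q2 :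
  tangent a b (p1 - p2) (q1 - q2) = tangent a b p1 q1 - tangent a b p2 q2.
Proof. by rewrite /tangent derivB !hornerE; ring. Qed.

Lemma tangentM a b p1 q1 p2 q2 :
  tangent a b (p1 * p2) (q1 * p2 + p1 * q2) =
  tangent a b p1 q1 * p2.[a] + p1.[a] * tangent a b p2 q2.
Proof. by rewrite /tangent derivM !hornerE; ring. Qed.

(** The subring of the dual numbers generated by [G] and a + b e: the candidate graph of an
    extension sending [a] to [b]. *)
Definition adjoin_graph (a b : L) : set (L * L) :=
  fun u => exists p q, poly_graph p q /\ u = (p.[a], tangent a b p q).

Lemma sub_adjoin_graph a b u : G u -> adjoin_graph a b u.
Proof.
case: u => c d cd; exists c%:P, d%:P; split; first exact: poly_graphC.
by rewrite /tangent derivC !hornerE.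
Qed.

Lemma adjoin_graph_gen a b : adjoin_graph a b (a, b).
Proof.
exists 'X, 0; split; last by rewrite /tangent derivX !hornerE.
by rewrite -['X]expr1; exact: poly_graphXn.
Qed.

(** The adjoined graph is a subring whatever [b] is; the hypothesis says that it still meets L e
    trivially, so that the extension is single-valued. *)
Lemma adjoin_graphP a b :
  (forall p q, poly_graph p q -> p.[a] = 0 -> tangent a b p q = 0) ->
  derivation_graph (adjoin_graph a b).
Proof.
move=> ker; split.
- by apply: sub_adjoin_graph; case: GG.
- move=> _ _ [p1 [q1 [h1 ->]]] [p2 [q2 [h2 ->]]].
  exists (p1 - p2), (q1 - q2); split; first exact: poly_graphB.
  by rewrite tangentB !hornerE.
- move=> _ _ [p1 [q1 [h1 ->]]] [p2 [q2 [h2 ->]]].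
  exists (p1 * p2), (q1 * p2 + p1 * q2); split; first exact: poly_graphM.
  by rewrite tangentM !hornerE.
- by move=> c [p [q [h [pa ->]]]]; apply: ker.
Qed.

Lemma poly_graph0 q : poly_graph 0 q -> q = 0.
Proof.
case: GG => _ _ _ g0 h; apply/polyP => i; rewrite coef0.
by apply: g0; have := h i; rewrite coef0.
Qed.

(** Without an algebraic relation on [a] over the domain, the choice of [b] is free. *)
Lemma adjoin_graph_transcendental a b :
  (forall p q, poly_graph p q -> p.[a] = 0 -> p = 0) ->
  derivation_graph (adjoin_graph a b).
Proof.
move=> tr; apply: adjoin_graphP => p q h pa.
have p0 := tr _ _ h pa; rewrite p0 in h *.
by rewrite (poly_graph0 h) /tangent deriv0 !hornerE.
Qed.

(* If a is a root of some p in the polynomial ring over the domain, a minimal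
   such p0 forces b = - q0(a) / p0'(a), with p0'(a) != 0 in characteristic 0. *)
Lemma adjoin_graph_exists a :
  [pchar L] =i pred0 -> exists b, derivation_graph (adjoin_graph a b).
Proof.
move=> charL.
pose vanishing n := exists p q,
  [/\ poly_graph p q, p.[a] = 0, p != 0 & size p = n].
case: (pselect (exists n, vanishing n)) => [exn|novan]; last first.
  exists 0; apply: adjoin_graph_transcendental => p q h pa.
  apply/eqP/negPn/negP => p0; apply: novan; exists (size p), p, q.
  by split.
have exn' : exists n, `[< vanishing n >] by case: exn => n /asboolT; exists n.
case: (ex_minnP exn') => n /asboolP[p0 [q0 [h0 p0a p0n0 sp0]]] minn.
have {}minn p q : poly_graph p q -> p.[a] = 0 -> p != 0 ->
    (size p0 <= size p)%N.
  by move=> h pa pn0; rewrite sp0; apply: minn; apply/asboolP; exists p, q.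
have sp1 : (1 < size p0)%N.
  rewrite ltnNge; apply/negP => /size1_polyC p0C.
  by move: p0a p0n0; rewrite p0C hornerC => ->; rewrite eqxx.
(* The derivative also has its coefficients in the domain and is non-zero in characteristic 0, so
   vanishing at [a] would contradict minimality. *)
have dp0 : p0^`().[a] != 0.
  apply/eqP => da; have := minn _ _ (poly_graph_deriv h0) da.
  have -> : p0^`() != 0.
    apply/eqP => /(congr1 (fun p : {poly L} => p`_(size p0).-2)) /eqP.
    rewrite coef_deriv coef0 prednK; last by case: (size p0) sp1 => [|[]].
    rewrite -/(lead_coef p0) -mulr_natr mulf_eq0 lead_coef_eq0 (negPf p0n0).
    rewrite ((pcharf0P L).1 charL).
    by case: (size p0) sp1 => [|[]].
  by move=> /(_ isT); rewrite leqNgt lt_size_deriv.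
exists (- q0.[a] / p0^`().[a]); set b := _ / _; apply: adjoin_graphP.
have t0 : tangent a b p0 q0 = 0.
  by rewrite /tangent /b mulrCA mulfV // mulr1 subrr.
(* The domain is only a ring, so [p] is reduced by pseudo-division: [c p - l X^k p0] is shorter,
   vanishes at [a], and has [c] times the tangent of [p], because [p0] has value and tangent 0. *)
move=> p q; move: {2}(size p) (leqnn (size p)) => s.
elim: s p q => [|s IH] p q.
  rewrite leqn0 size_poly_eq0 => /eqP-> h _.
  by rewrite (poly_graph0 h) /tangent deriv0 !hornerE.
move=> sp h pa.
case: (eqVneq p 0) => [p_0|pn0].
  rewrite p_0 in h *.
  by rewrite (poly_graph0 h) /tangent deriv0 !hornerE.
have sp0p := minn _ _ h pa pn0.
pose c := lead_coef p0; pose c' := q0`_(size p0).-1.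
pose l := lead_coef p; pose l' := q`_(size p).-1.
pose k := (size p - size p0)%N.
have hc : poly_graph c%:P c'%:P by apply: poly_graphC; exact: h0.
have hl : poly_graph l%:P l'%:P by apply: poly_graphC; exact: h.
have hm := poly_graphM hl (poly_graphM (poly_graphXn k) h0).
have /IH : (size (c%:P * p - l%:P * ('X^k * p0))%R <= s)%N.
  apply/leq_sizeP => j sj; rewrite coefB !coefCM coefXnM.
  have [pj|jp] := leqP (size p) j.
    rewrite (nth_default 0 pj) mulr0 sub0r.
    have p0j : (size p0 <= j - k)%N by rewrite /k; lia.
    by rewrite (nth_default 0 p0j) if_same mulr0 oppr0.
  have -> : j = (size p).-1 by lia.
  have -> : ((size p).-1 < k)%N = false by rewrite /k; lia.
  have -> : ((size p).-1 - k = (size p0).-1)%N by rewrite /k; lia.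
  by rewrite /c /l !lead_coefE mulrC subrr.
move/(_ _ (poly_graphB (poly_graphM hc h) hm)).
rewrite tangentB !tangentM t0 hornerD hornerN !hornerM hornerC pa p0a.
rewrite !(mulr0, addr0, subr0, oppr0) add0r => /(_ erefl)/eqP.
by rewrite mulf_eq0 lead_coef_eq0 (negPf p0n0) => /eqP.
Qed.
End Graph.

(* Zorn's lemma on the graphs of derivations containing that of D. *)
Lemma derivation_extension (K L : fieldType) (f : {rmorphism K -> L})
    (D : K -> K) (x b : L) :
  [pchar L] =i pred0 -> derivation D ->
  (forall p : {poly K}, (map_poly f p).[x] = 0 -> p = 0) ->
  exists D' : L -> L,
    [/\ derivation D', forall c, D' (f c) = f (D c) & D' x = b].
Proof.
move=> charL dD trx; have [DD DM] := dD.
have D0 := derivation0 dD; have D1 := derivation1 dD.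
have DB a c : D (a - c) = D a - D c.
  by apply: (addIr (D c)); rewrite -DD !subrK.
pose G0 : set (L * L) := fun u => exists c, u = (f c, f (D c)).
have gG0 : derivation_graph G0.
  split.
  - by exists 1; rewrite D1 rmorph1 rmorph0.
  - by move=> _ _ [c ->] [d ->]; exists (c - d); rewrite DB !rmorphB.
  - by move=> _ _ [c ->] [d ->]; exists (c * d); rewrite DM rmorphD !rmorphM.
  - by move=> b' [c [/esym/eqP]]; rewrite fmorph_eq0 => /eqP-> ->; rewrite D0 rmorph0.
have gG1 : derivation_graph (adjoin_graph G0 x b).
  apply: adjoin_graph_transcendental => // p q h px.
  have [p' pE] : exists p', p = map_poly f p'.
    have /choice[g gE] i : exists c, p`_i = f c by case: (h i) => c [-> _]; exists c.
    exists (\poly_(i < size p) g i); apply/polyP => i.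
    rewrite coef_map coef_poly; case: ltnP => [_|pi]; first exact: gE.
    by rewrite raddf0 nth_default.
  by rewrite pE (trx p') ?rmorph0 // -pE.
set G1 := adjoin_graph G0 x b in gG1.
(* Uniting with [G1] covers the empty chain and forces the maximal graph to contain [G1]. *)
have [A [gA maxA]] : exists A, derivation_graph (A `|` G1)%classic /\
    forall B, (A `<` B)%classic -> ~ derivation_graph (B `|` G1)%classic.
  apply: (@Zorn_bigcup _ (fun A => derivation_graph (A `|` G1)%classic)).
  move=> C gC totC.
  case: (pselect (exists A, C A)) => [[A0 CA0]|noC]; last first.
    suff -> : (\bigcup_(X in C) X `|` G1)%classic = G1 by [].
    apply/seteqP; split=> u; last by right.
    by case=> // -[X CX _]; case: noC; exists X.
  have cup2 u v : (\bigcup_(X in C) X `|` G1)%classic u ->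
      (\bigcup_(X in C) X `|` G1)%classic v ->
      exists2 X, C X & (X `|` G1)%classic u /\ (X `|` G1)%classic v.
    case=> [[X CX Xu]|Gu] [[Y CY Yv]|Gv].
    - have [XY|YX] := totC _ _ CX CY.
        by exists Y => //; split; left => //; apply: XY.
      by exists X => //; split; left => //; apply: YX.
    - by exists X => //; split; [left|right].
    - by exists Y => //; split; [right|left].
    - by exists A0 => //; split; right.
  have sub X u : C X -> (X `|` G1)%classic u ->
      (\bigcup_(X in C) X `|` G1)%classic u.
    by move=> CX [Xu|Gu]; [left; exists X|right].
  split.
  - by right; case: gG1.
  - move=> u v hu hv; have [X CX [Xu Xv]] := cup2 _ _ hu hv.
    by apply: (sub X) => //; case: (gC _ CX) => _ gB _ _; apply: gB.
  - move=> u v hu hv; have [X CX [Xu Xv]] := cup2 _ _ hu hv.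
    by apply: (sub X) => //; case: (gC _ CX) => _ _ gM _; apply: gM.
  - move=> c hc; have [X CX [Xc _]] := cup2 _ _ hc hc.
    by case: (gC _ CX) => _ _ _; apply.
set M := (A `|` G1)%classic in gA.
(* A maximal graph is total, since a missing [a] could be adjoined. *)
have totM a : exists c, M (a, c).
  have [c gc] := adjoin_graph_exists gA a charL.
  exists c; apply: contrapT => Mac.
  apply: (maxA (adjoin_graph M a c)).
    split=> [u Au|sub]; first by apply: sub_adjoin_graph => //; left.
    by apply: Mac; left; apply: sub; exact: adjoin_graph_gen.
  suff -> : (adjoin_graph M a c `|` G1)%classic = adjoin_graph M a c by [].
  apply/seteqP; split=> u; last by left.
  by case=> // Gu; apply: sub_adjoin_graph => //; right.
have [D' D'M] := choice totM.
have D'E a c : M (a, c) -> D' a = c by exact: graph_fun.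
exists D'; split.
- split=> a c; apply: D'E.
    exact: (graphD gA (D'M a) (D'M c)).
  by case: gA => _ _ gM _; exact: (gM _ _ (D'M a) (D'M c)).
- move=> c; apply: D'E; right; apply: sub_adjoin_graph => //; by exists c.
- by apply: D'E; right; exact: adjoin_graph_gen.
Qed.

(** * A generic point *)

Definition map_tensor (K L : fieldType) (f : K -> L) (m k : nat)
  (T : Ten K m k) : Ten L m k := [ffun idx => f (T idx)].

(** [A] stands for a tensor of forms of degree [d], stored by coefficients; [c] is the point of
    evaluation. *)
Definition eval_tensor (K : fieldType) (n d m k : nat)
  (A : monom n d -> Ten K m k) (c : 'I_n -> K) : Ten K m k :=
  [ffun idx => \sum_a A a idx * \prod_i c i ^+ (val a i : nat)].

Lemma sum_of_pureP (K : fieldType) (m k : nat) (T : Ten K m k) (r : nat) :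
  sum_of_pure T r <-> exists v : 'I_r -> 'I_k -> 'I_m -> K,
    forall idx, T idx = \sum_j \prod_t v j t (idx t).
Proof.
split=> -[v Tv]; exists v.
  by move=> idx; rewrite Tv sum_ffunE; apply: eq_bigr => j _; rewrite ffunE.
apply/ffunP => idx; rewrite Tv sum_ffunE.
by apply: eq_bigr => j _; rewrite ffunE.
Qed.

Lemma ultra_class_sum (K : fieldType) (I : finType) (u : I -> nat -> K) :
  ultra_class (fun s => \sum_i u i s) = \sum_i ultra_class (u i).
Proof. by rewrite -raddf_sum fct_sumE. Qed.

Lemma ultra_class_prod (K : fieldType) (I : finType) (u : I -> nat -> K) :
  ultra_class (fun s => \prod_i u i s) = \prod_i ultra_class (u i).
Proof. by rewrite -rmorph_prod fct_prodE. Qed.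

Lemma ultra_classM (K : fieldType) (u v : nat -> K) :
  ultra_class (fun s => u s * v s) = ultra_class u * ultra_class v.
Proof. by rewrite -rmorphM. Qed.

Lemma ultra_classX (K : fieldType) (u : nat -> K) e :
  ultra_class (fun s => u s ^+ e) = ultra_class u ^+ e.
Proof.
elim: e => [|e IH]; first exact: (rmorph1 (@ultra_class K)).
rewrite exprS -IH -ultra_classM; congr ultra_class.
by apply/funext => s; rewrite exprS.
Qed.

(** A decomposition is chosen at each index; as all have the same number [r] of summands, the
    classes of their vectors give one over the ultrapower. *)
Lemma ultrapower_eval_tensor (K : fieldType) (n d m k r : nat)
    (A : monom n d -> Ten K m k) :
  (forall c, sum_of_pure (eval_tensor A c) r) ->
  forall c, sum_of_pure
    (eval_tensor (fun a => map_tensor (@ultra_const K) (A a)) c) r.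
Proof.
move=> rA c; apply/sum_of_pureP.
have /choice[v vE] s : exists v : 'I_r -> 'I_k -> 'I_m -> K, forall idx,
    eval_tensor A (fun i => ultra_repr (c i) s) idx =
    \sum_j \prod_t v j t (idx t).
  exact/sum_of_pureP.
exists (fun j t l => ultra_class (fun s => v s j t l)) => idx.
rewrite ffunE.
under [RHS]eq_bigr do rewrite -ultra_class_prod.
rewrite -ultra_class_sum.
have -> : (fun s => \sum_j \prod_t v s j t (idx t)) =
   (fun s => \sum_a A a idx * \prod_i ultra_repr (c i) s ^+ (val a i : nat)).
  by apply/funext => s; rewrite -vE ffunE.
rewrite ultra_class_sum; apply: eq_bigr => a _.
rewrite ultra_classM ultra_class_prod ffunE; congr (_ * _).
by apply: eq_bigr => i _; rewrite ultra_classX ultra_reprK.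
Qed.

(** There are finitely many equations, one per entry, each true on a large set; an index common to
    these sets gives vectors over [K]. *)
Lemma ultrapower_descent (K : fieldType) (m k R : nat) (T : Ten K m k) :
  sum_of_pure (map_tensor (@ultra_const K) T) R -> sum_of_pure T R.
Proof.
move=> /sum_of_pureP[v vE]; apply/sum_of_pureP.
have [s sE] : exists s, forall idx,
    T idx = \sum_j \prod_t ultra_repr (v j t (idx t)) s.
  apply: (@filter_ex _ ultra); apply: filter_forall => idx.
  apply/(@ultra_classP K); rewrite ultra_class_sum.
  have := vE idx; rewrite ffunE => e.
  rewrite [LHS]e; apply: eq_bigr => j _.
  by rewrite ultra_class_prod; apply: eq_bigr => t _; rewrite ultra_reprK.
by exists (fun j t l => ultra_repr (v j t l) s).
Qed.

Lemma pchar0_rmorph (K L : fieldType) (f : {rmorphism K -> L}) :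
  [pchar K] =i pred0 -> [pchar L] =i pred0.
Proof. by move=> charK p; rewrite (fmorph_pchar f). Qed.

(** Each of [s] successive ultrapowers contributes one coordinate, transcendental over the field
    before it. The rank bound is kept at all points [c], so that the induction can use it again. *)
Lemma generic_point (F : fieldType) (n d m k r : nat)
    (A : monom n d -> Ten F m k) (s : nat) :
  [pchar F] =i pred0 -> (forall c, sum_of_pure (eval_tensor A c) r) ->
  exists (K : fieldType) (f : {rmorphism F -> K}) (x : nat -> K)
    (D : nat -> K -> K),
  [/\ [pchar K] =i pred0,
      forall c, sum_of_pure (eval_tensor (fun a => map_tensor f (A a)) c) r,
      forall (T : Ten F m k) R,
        sum_of_pure (map_tensor f T) R -> sum_of_pure T R
    & forall i, (i < s)%N -> [/\ derivation (D i), forall c, D i (f c) = 0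
        & forall j, (j < s)%N -> D i (x j) = (i == j)%:R]].
Proof.
move=> charF rA; elim: s => [|s [K [f [x [D [charK rK desc DK]]]]]].
  exists F, idfun, (fun=> 0), (fun=> fun=> 0); split=> //.
    by move=> c; have := rA c; congr sum_of_pure; apply/ffunP => idx;
      rewrite !ffunE; apply: eq_bigr => a _; rewrite ffunE.
  by move=> T R; congr sum_of_pure; apply/ffunP => idx; rewrite ffunE.
pose g := @ultra_const K : {rmorphism K -> ultrapower K}.
have charL := pchar0_rmorph g charK.
have tr p : (map_poly g p).[ultra_id K] = 0 -> p = 0.
  exact: ultra_id_transcendental.
pose x' j := if j == s then ultra_id K else g (x j).
have D_ i : exists D', (i < s.+1)%N ->
    [/\ derivation D', forall c, D' (g (f c)) = 0
      & forall j, (j < s.+1)%N -> D' (x' j) = (i == j)%:R].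
  have [is_|si] := ltnP i s.
    (* An old derivation extends with value 0 at the new coordinate. *)
    have [Di Dif Dix] := DK i is_.
    have [D' [D'd D'g D'x]] := derivation_extension 0 charL Di tr.
    exists D' => _; split=> // [c|j]; first by rewrite D'g Dif rmorph0.
    rewrite /x'; case: eqVneq => [->|js] jS; first by rewrite D'x ltn_eqF.
    by rewrite D'g Dix ?rmorph_nat // ltn_neqAle js.
  (* The new derivation extends the zero derivation, with value 1 at the new coordinate. *)
  have Z : derivation (fun _ : K => 0 : K).
    by split=> a b; rewrite !(mulr0, mul0r, addr0).
  have [D' [D'd D'g D'x]] := derivation_extension 1 charL Z tr.
  exists D' => iS; have <- : i = s by apply/eqP; rewrite eqn_leq si andbT.
  split=> // [c|j]; first by rewrite D'g rmorph0.
  have es : s = i by apply/eqP; rewrite eqn_leq si.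
  rewrite /x' es; case: eqVneq => [->|ji] jS; first by rewrite D'x.
  by rewrite D'g rmorph0.
have [D' D'P] := choice D_.
exists (ultrapower K), (g \o f), x', D'; split=> //.
- move=> c; have := ultrapower_eval_tensor rK c.
  congr sum_of_pure; apply/ffunP => idx; rewrite !ffunE.
  by apply: eq_bigr => a _; rewrite !ffunE.
- move=> T R TR; apply: desc; apply: ultrapower_descent.
  move: TR; congr sum_of_pure; apply/ffunP => idx; by rewrite !ffunE.
Qed.

(** * Words of derivations *)

Section Words.
Variables (K : fieldType) (n : nat) (D : 'I_n -> K -> K).
Hypothesis DD : forall i, derivation (D i).

(** The last letter acts first, which is why monomials are treated by induction from the end of the
    word. *)
Definition Dword (w : seq 'I_n) (a : K) : K := foldr D a w.

Lemma Dword_sum (I : Type) (r : seq I) (P : pred I) (g : I -> K) w :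
  Dword w (\sum_(i <- r | P i) g i) = \sum_(i <- r | P i) Dword w (g i).
Proof. by elim: w => //= i w ->; exact: derivation_sum. Qed.

Lemma DwordZ w c a : (forall i, D i c = 0) -> Dword w (c * a) = c * Dword w a.
Proof.
by move=> Dc; elim: w => //= i w ->; rewrite (proj2 (DD i)) Dc mul0r add0r.
Qed.

(* The tuple s records which factor each letter of w differentiates. *)
Lemma Dword_prod d (w : seq 'I_n) k (g : 'I_k -> K) : size w = d ->
  Dword w (\prod_t g t) =
  \sum_(s : d.-tuple 'I_k) \prod_t Dword (mask [seq x == t | x <- s] w) (g t).
Proof.
elim: d w => [|d IH] w.
  move/size0nil->; rewrite (big_pred1 [tuple]); last first.
    by move=> s; apply/esym/eqP; exact: tuple0.
  by apply: eq_bigr => t _.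
case: w => // i w [/IH /= ->]; rewrite derivation_sum //.
rewrite (reindex (fun p : 'I_k * d.-tuple 'I_k => cons_tuple p.1 p.2)); last first.
  exists (fun s => (thead s, behead_tuple s)) => [[x s]|s] _ /=.
    by rewrite theadE; congr pair; apply: val_inj.
  by rewrite [RHS]tuple_eta.
rewrite -(pair_big predT predT (fun x (s : d.-tuple 'I_k) => \prod_t Dword
   (mask [seq y == t | y <- cons_tuple x s] (i :: w)) (g t))) /= exchange_big /=.
apply: eq_bigr => s _; rewrite derivation_prod //; apply: eq_bigr => x _.
by apply: eq_bigr => t _; rewrite eq_sym; case: (x == t).
Qed.

Variable x : 'I_n -> K.
Hypothesis Dx : forall i j, D i (x j) = (i == j)%:R.

(** Where truncation occurs in [b j - (j == i)], the factor [b i] is 0. *)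
Lemma D_monomial i (b : 'I_n -> nat) :
  D i (\prod_j x j ^+ b j) =
  (b i)%:R * \prod_j x j ^+ (b j - (j == i)).
Proof.
rewrite derivation_prod // (bigD1 i) //= [X in _ + X]big1 ?addr0; last first.
  move=> s si; rewrite (bigD1 s) //= eqxx derivationX // Dx eq_sym (negPf si).
  by rewrite mulr0 mul0r.
rewrite (bigD1 i) //= eqxx derivationX // Dx eqxx mulr1 -mulrA; congr (_ * _).
rewrite [RHS](bigD1 i) //= eqxx subn1; congr (_ * _).
by apply: eq_bigr => j ji; rewrite (negPf ji) subn0.
Qed.

(** Each letter lowers its exponent by one and brings out the old exponent as a factor. The length
    being the degree, either all exponents are used up exactly, leaving the factorials, or one is
    exhausted too early, giving 0. *)
Lemma Dword_monomial w (b : 'I_n -> nat) : (\sum_j b j)%N = size w ->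
  Dword w (\prod_j x j ^+ b j) =
  if [forall j, b j == count_mem j w] then (\prod_j (b j)`!)%:R else 0.
Proof.
elim/last_ind: w b => [|w i IH] b.
  move/eqP; rewrite sum_nat_eq0 => /forallP b0.
  have {}b0 j : b j = 0%N by apply/eqP; have := b0 j.
  case: forallP => [_|[j]]; last by rewrite b0.
  by rewrite !big1 // => j _; rewrite b0.
rewrite size_rcons /Dword foldr_rcons -/(Dword _ _) D_monomial => sb.
rewrite DwordZ; last by move=> j; exact: derivation_nat.
case: (posnP (b i)) => [bi|bi].
  rewrite bi mul0r; case: forallP => // /(_ i).
  by rewrite bi -cats1 count_cat /= eqxx addn1.
rewrite IH; last first.
  move: sb; rewrite (bigD1 i) //= [in X in _ -> X](bigD1 i) //= eqxx.
  rewrite [X in (_ + X)%N = size w](eq_bigr b); first by lia.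
  by move=> j /negPf ->; rewrite subn0.
have -> : [forall j, b j - (j == i) == count_mem j w]%N =
    [forall j, b j == count_mem j (rcons w i)].
  apply: eq_forallb => j; rewrite -cats1 count_cat /= addn0 [i == j]eq_sym.
  by case: (eqVneq j i) => [->|_]; lia.
case: ifP; last by rewrite mulr0.
move=> _; rewrite -natrM; congr _%:R.
rewrite [RHS](bigD1 i) //= (bigD1 i) //= eqxx mulnA subn1.
rewrite -{1}(prednK bi) -factS prednK //; congr (_ * _)%N.
by apply: eq_bigr => j /negPf ->; rewrite subn0.
Qed.

End Words.

(** * Combinatorics of monomials and words *)

Lemma word_of_monom n d (a : monom n d) :
  exists w : d.-tuple 'I_n, forall j, count_mem j w = val a j.
Proof.
pose s := flatten [seq nseq (val a j : nat) j | j <- enum 'I_n].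
have cs j : count_mem j s = val a j.
  rewrite count_flatten -map_comp sumnE big_map big_enum /=.
  rewrite (bigD1 j) //= count_nseq /= eqxx mul1n big1 ?addn0 // => i ij.
  by rewrite count_nseq /= (negPf ij).
have sd : size s == d.
  rewrite size_flatten /shape -map_comp sumnE big_map big_enum /=.
  rewrite -[X in _ == X](eqP (valP a)); apply/eqP.
  by apply: eq_bigr => j _; rewrite size_nseq.
by exists (Tuple sd).
Qed.

Lemma prod_fact_le (I : Type) (r : seq I) (b : I -> nat) :
  (\prod_(i <- r) (b i)`! <= (\sum_(i <- r) b i)`!)%N.
Proof.
elim: r => [|i r IH]; first by rewrite !big_nil.
rewrite !big_cons; apply: leq_trans (leq_mul (leqnn _) IH) _.
have le : (b i <= b i + \sum_(j <- r) b j)%N by rewrite leq_addr.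
rewrite -(bin_fact le) addKn leq_pmull // bin_gt0 //.
Qed.

(** With characteristic 0, this makes the scalars [N b] of [sum_of_pure_linear] invertible. *)
Lemma multinom_gt0 n d (a : monom n d) : (0 < multinom a)%N.
Proof.
rewrite /multinom divn_gt0; last first.
  by rewrite prodn_gt0 // => i; rewrite fact_gt0.
by rewrite -[in X in (_ <= X)%N](eqP (valP a)) prod_fact_le.
Qed.

(** For [t != t0] the positions where [s] is [t] are among those where [s] is not [t0], so their
    letters can be read off from the kept ones. *)
Lemma eq_mask_off (I : eqType) (k : eqType) (s : seq k) (t0 t : k)
    (w w' : seq I) :
  size w = size s -> size w' = size s -> t != t0 ->
  mask [seq x != t0 | x <- s] w = mask [seq x != t0 | x <- s] w' ->
  mask [seq x == t | x <- s] w = mask [seq x == t | x <- s] w'.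
Proof.
move=> + + tt0; elim: s w w' => [|x s IH] [|i w] [|i' w'] //= [sw] [sw'].
case: (eqVneq x t0) => [->|xt0] /=.
  by rewrite eq_sym (negPf tt0); exact: IH.
by move=> [<- /(IH _ _ sw sw') ->].
Qed.

(** The [k] counts add up to [d], so not all lie below d / k. *)
Lemma pigeonhole_tuple d k (s : d.-tuple 'I_k) : (0 < k)%N ->
  exists t, (d <= k * count_mem t s)%N.
Proof.
move=> k0; apply/existsP; apply: contraT; rewrite negb_exists => /forallP lt.
have ds : (\sum_(t < k) count_mem t s)%N = d.
  rewrite -[RHS](size_tuple s); elim: (tval s) => [|x r IH] /=.
    by rewrite big1.
  rewrite big_split /= IH (bigD1 x) //= eqxx big1 // => i /negPf.
  by rewrite eq_sym => ->.
have : (\sum_(t < k) k * count_mem t s < \sum_(t < k) d)%N.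
  case: k s k0 lt {ds} => // k s _ lt.
  rewrite big_ord_recl [X in (_ < X)%N]big_ord_recl -addSn leq_add //.
    by rewrite ltnNge lt.
  by apply: leq_sum => i _; rewrite ltnW // ltnNge lt.
by rewrite -big_distrr /= ds sum_nat_const card_ord ltnn.
Qed.

Lemma sum_of_pure_fin (K : fieldType) (m k : nat) (J : finType)
    (v : J -> 'I_k -> 'I_m -> K) :
  sum_of_pure (\sum_j pure_tensor (v j) : Ten K m k) #|J|.
Proof.
exists (fun i => v (enum_val i)).
by rewrite (reindex (@enum_val J J)) //; apply: onW_bij; exact: enum_val_bij.
Qed.

(** * Rank bounds *)

(** The hypothesis on [e] says that [e] is at least the floor of (k - 1)d / k. The pure tensors are
    indexed by a summand [j], an assignment [s] of letters to factors, and a word of length [e]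
    recording the letters that miss the factor [t0 s]. *)
Lemma sum_of_pure_Leibniz (K : fieldType) (n d m k r e : nat) (I : finType)
    (D : 'I_n -> K -> K) (w : I -> d.-tuple 'I_n) (C : I -> K)
    (V : 'I_r -> 'I_k -> 'I_m -> K) (T : Ten K m k) :
  (0 < k)%N -> (0 < n)%N -> ((k - 1) * d < k * e.+1)%N ->
  (forall idx, T idx = \sum_b C b * \sum_j \sum_(s : d.-tuple 'I_k)
     \prod_t Dword D (mask [seq x == t | x <- s] (w b)) (V j t (idx t))) ->
  sum_of_pure T (r * k ^ d * n ^ e).
Proof.
move=> k0 n0 he TE.
have [t0 t0P] := choice (fun s : d.-tuple 'I_k => pigeonhole_tuple s k0).
pose i0 := Ordinal n0.
pose off (s : d.-tuple 'I_k) b := mask [seq x != t0 s | x <- s] (w b).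
have size_off s b : (size (off s b) <= e)%N.
  have sc : size (off s b) = (d - count_mem (t0 s) s)%N.
    rewrite /off size_mask ?size_map ?size_tuple // count_map.
    rewrite -[X in (X - _)%N](size_tuple s) -(count_predC (pred1 (t0 s)) s).
    by rewrite addKn.
  (* With q the count, k (d - q) <= (k - 1) d < k (e + 1). *)
  rewrite sc; have := t0P s; have := count_size (pred1 (t0 s)) s.
  rewrite size_tuple; nia.
(* Padding with [i0] to length [e] gives n^e possible keys; it loses nothing, because the unpadded
   length depends on [s] only. *)
pose key s b : e.-tuple 'I_n := [tuple nth i0 (off s b) p | p < e].
have keyP s b b' : key s b = key s b' -> off s b = off s b'.
  have so c : size (off s c) = count predT (mask [seq x != t0 s | x <- s] (w b)).
    by rewrite count_predT /off !size_mask // size_map !size_tuple.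
  move=> kk; apply: (@eq_from_nth _ i0) => [|p pb]; first by rewrite !so.
  have pe : (p < e)%N := leq_trans pb (size_off s b).
  have := congr1 (fun u : e.-tuple 'I_n => tnth u (Ordinal pe)) kk.
  by rewrite !tnth_mktuple.
pose on (s : d.-tuple 'I_k) (t : 'I_k) b := mask [seq x == t | x <- s] (w b).
have on_eq s t b b' : t != t0 s -> key s b = key s b' -> on s t b = on s t b'.
  by move=> tt0 /keyP; apply: eq_mask_off; rewrite ?size_tuple.
pose J := ('I_r * d.-tuple 'I_k * e.-tuple 'I_n)%type.
(* Factor [t0 s] sums over all [b] with key [u]; the other factors do not depend on the choice among
   these [b]. If there is none, the sum is empty and the tensor is zero. *)
pose v (q : J) t l : K := let: (j, s, u) := q in
  if t == t0 s then
    \sum_(b | key s b == u) C b * Dword D (on s t b) (V j t l)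
  else if [pick b | key s b == u] is Some b then Dword D (on s t b) (V j t l)
  else 0.
have -> : (r * k ^ d * n ^ e)%N = #|{: J}|.
  by rewrite !card_prod !card_tuple !card_ord.
suff -> : T = \sum_q pure_tensor (v q) by exact: sum_of_pure_fin.
apply/ffunP => idx; rewrite TE sum_ffunE.
under eq_bigr do rewrite mulr_sumr.
have -> : \sum_q pure_tensor (v q) idx =
    \sum_j \sum_s \sum_u pure_tensor (v (j, s, u)) idx.
  by rewrite pair_bigA pair_bigA; apply: eq_bigr => -[[j s] u].
rewrite exchange_big /=; apply: eq_bigr => j _.
under eq_bigr do rewrite mulr_sumr.
rewrite exchange_big /=; apply: eq_bigr => s _.
rewrite (partition_big (key s) predT) //=; apply: eq_bigr => u _.
rewrite ffunE (bigD1 (t0 s)) //= eqxx mulr_suml; apply: eq_bigr => b /eqP bu.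
rewrite (bigD1 (t0 s)) //= -mulrA; congr (_ * (_ * _)).
apply: eq_bigr => t /[dup] tt0 /negPf ->; case: pickP => [b' /eqP b'u|/(_ b)].
  by rewrite -/(on s t b) (@on_eq s t b b') // bu b'u.
by rewrite bu eqxx.
Qed.

(** * Existence of the rank and of its maxima *)

(** Expansion in the standard basis, with the coefficient put into factor [t0]. This common bound
    makes the minimum in [trk] and the maximum in [mu_max] exist. *)
Lemma sum_of_pure_card (K : fieldType) (m k : nat) (T : Ten K m k) :
  (0 < k)%N -> sum_of_pure T #|{: {ffun 'I_k -> 'I_m}}|.
Proof.
move=> k0; pose t0 := Ordinal k0.
pose v (q : {ffun 'I_k -> 'I_m}) t l : K :=
  (if t == t0 then T q else 1) * (q t == l)%:R.
suff -> : T = \sum_q pure_tensor (v q) by exact: sum_of_pure_fin.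
apply/ffunP => idx; rewrite sum_ffunE (bigD1 idx) //= big1 ?addr0.
  rewrite ffunE (bigD1 t0) //= /v !eqxx mulr1 big1 ?mulr1 // => t /negPf->.
  by rewrite eqxx mulr1.
move=> q qidx; rewrite ffunE.
have [t qt] : exists t, q t != idx t.
  apply/existsP; apply: contraR qidx; rewrite negb_exists => /forallP qE.
  by apply/eqP/ffunP => t; apply/eqP/negPn.
by rewrite (bigD1 t) //= /v (negPf qt) mulr0 mul0r.
Qed.

Lemma trkP (K : fieldType) (m k : nat) (T : Ten K m k) : (0 < k)%N ->
  sum_of_pure T (trk T) /\ forall r, sum_of_pure T r -> (trk T <= r)%N.
Proof.
move=> k0; apply: (ClassicalEpsilon.epsilon_spec (inhabits 0%N)
  (fun r => sum_of_pure T r /\ forall r', sum_of_pure T r' -> (r <= r')%N)).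
have exT : exists r, `[< sum_of_pure T r >].
  by exists #|{: {ffun 'I_k -> 'I_m}}|; apply/asboolP/sum_of_pure_card.
case: (ex_minnP exT) => r /asboolP Tr minr.
by exists r; split=> // r' /asboolT; exact: minr.
Qed.

Lemma trk_bounded (K : fieldType) (m k : nat) (T : Ten K m k) : (0 < k)%N ->
  (trk T <= #|{: {ffun 'I_k -> 'I_m}}|)%N.
Proof. by move=> k0; have [_] := trkP T k0; apply; exact: sum_of_pure_card. Qed.

Lemma mu_maxP (I V : Type) (F : fieldType) (m k : nat)
    (phi : V -> Ten F m k) (g : I -> V) (i0 : I) : (0 < k)%N ->
  (exists x, trk (phi (g x)) = mu_max phi g) /\
  forall x, (trk (phi (g x)) <= mu_max phi g)%N.
Proof.
move=> k0; apply: (ClassicalEpsilon.epsilon_spec (inhabits 0%N)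
  (fun M => (exists x, trk (phi (g x)) = M) /\
     forall x, (trk (phi (g x)) <= M)%N)).
have exM : exists M, `[< exists x, trk (phi (g x)) = M >].
  by exists (trk (phi (g i0))); apply/asboolP; exists i0.
have bM M : `[< exists x, trk (phi (g x)) = M >] ->
    (M <= #|{: {ffun 'I_k -> 'I_m}}|)%N.
  by move=> /asboolP[x <-]; exact: trk_bounded.
case: (ex_maxnP exM bM) => M /asboolP[x xM] maxM.
exists M; split=> [|y]; first by exists x.
by apply: maxM; apply/asboolP; exists y.
Qed.

(** Zero vectors pad the decomposition; a factor must exist for their product to vanish. *)
Lemma sum_of_pure_mono (K : fieldType) (m k r r' : nat) (T : Ten K m k) :
  (0 < k)%N -> (r <= r')%N -> sum_of_pure T r -> sum_of_pure T r'.
Proof.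
move=> k0 rr' [v ->].
exists (fun j t l => if insub (j : nat) is Some i then v i t l else 0).
rewrite -(big_mkord predT (fun j => pure_tensor (fun t l =>
  if insub j is Some i then v i t l else 0))).
rewrite (big_cat_nat _ rr') //= [X in _ + X]big1_seq ?addr0.
  rewrite big_mkord; apply: eq_bigr => j _; apply/ffunP => idx.
  by rewrite !ffunE; apply: eq_bigr => t _; rewrite valK.
move=> j; rewrite mem_index_iota => /andP[_ /andP[rj _]].
apply/ffunP => idx; rewrite !ffunE (bigD1 (Ordinal k0)) //=.
by rewrite insubN ?mul0r // -leqNgt.
Qed.

(** * Rank bound for the image of an arbitrary form *)

Section Potential.
Variables (F : fieldType) (d k : nat).
Hypotheses (charF : [pchar F] =i pred0) (k0 : (0 < k)%N).
Variables (n m : nat) (n0 : (0 < n)%N).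
Variable phi : {linear Pol F n d -> Ten F m k}.

Definition monom_poly (a : monom n d) : Pol F n d := [ffun b => (b == a)%:R].

(** The multinomial factor of [lin_pow] is included, so these are the coefficients of phi(l^d) as a
    form in the coefficients of l. *)
Definition coef_tensor (a : monom n d) : Ten F m k :=
  [ffun idx => (multinom a)%:R * phi (monom_poly a) idx].

Lemma linear_monomE (p : Pol F n d) idx :
  phi p idx = \sum_a p a * phi (monom_poly a) idx.
Proof.
have {1}-> : p = \sum_a p a *: monom_poly a.
  apply/ffunP => b; rewrite sum_ffunE (bigD1 b) //= big1 ?addr0.
    by rewrite !ffunE eqxx [LHS](esym (mulr1 _)).
  by move=> a /negPf ab; rewrite !ffunE eq_sym ab [LHS]mulr0.
rewrite linear_sum sum_ffunE; apply: eq_bigr => a _.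
by rewrite linearZ ffunE.
Qed.

Lemma eval_coef_tensor (c : 'I_n -> F) :
  eval_tensor coef_tensor c = phi (lin_pow d c).
Proof.
apply/ffunP => idx; rewrite ffunE linear_monomE; apply: eq_bigr => a _.
by rewrite !ffunE mulrAC.
Qed.

Lemma sum_of_pure_linear r e (p : Pol F n d) :
  ((k - 1) * d < k * e.+1)%N ->
  (forall c, sum_of_pure (phi (lin_pow d c)) r) ->
  sum_of_pure (phi p) (r * k ^ d * n ^ e).
Proof.
move=> he rphi.
have rA c : sum_of_pure (eval_tensor coef_tensor c) r.
  by rewrite eval_coef_tensor.
have [K [f [x [D [charK rK desc DK]]]]] := generic_point n charF rA.
apply: desc.
pose Dn (i : 'I_n) := D i; pose xn (i : 'I_n) := x i.
have DD i : derivation (Dn i) by case: (DK i (ltn_ord i)).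
have Df i c : Dn i (f c) = 0 by case: (DK i (ltn_ord i)) => _ Df _; exact: Df.
have Dx i j : Dn i (xn j) = (i == j)%:R.
  by case: (DK i (ltn_ord i)) => _ _ Dx; exact: Dx.
have /sum_of_pureP[V VE] := rK xn.
have [w wE] := choice (@word_of_monom n d).
(* The multinomial comes from [coef_tensor], the factorials from differentiating the monomial [b] by
   [w b]. *)
pose N (b : monom n d) := (multinom b * \prod_i (val b i : nat)`!)%N.
apply: (@sum_of_pure_Leibniz _ _ _ _ _ _ _ _ Dn w
  (fun b => f (p b) * (N b)%:R^-1) V) => // idx.
rewrite ffunE linear_monomE rmorph_sum; apply: eq_bigr => b _.
under eq_bigr do rewrite -(Dword_prod DD) ?size_tuple //.
rewrite -(Dword_sum DD) -VE ffunE (Dword_sum DD) (bigD1 b) //=.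
(* At the generic point the word [w b] kills every monomial of degree [d] except [b]. *)
have mon a : Dword Dn (w b) (map_tensor f (coef_tensor a) idx *
    \prod_i xn i ^+ (val a i : nat)) =
    if a == b then f (phi (monom_poly b) idx) * (N b)%:R else 0.
  rewrite !ffunE (DwordZ DD) // (Dword_monomial DD Dx); last first.
    by rewrite size_tuple; apply/eqP; exact: (valP a).
  have -> : [forall j, (val a j : nat) == count_mem j (w b)] = (a == b).
    apply/forallP/eqP => [ab|-> j]; last by rewrite wE.
    apply/val_inj/ffunP => j; apply/val_inj/eqP.
    by have := ab j; rewrite wE.
  case: eqP => [->|_]; last by rewrite mulr0.
  by rewrite rmorphM rmorph_nat /N natrM; ring.
rewrite [X in _ + X]big1 ?addr0; last by move=> a /negPf ab; rewrite mon ab.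
rewrite mon eqxx rmorphM -mulrA; congr (_ * _).
rewrite mulrCA mulVf ?mulr1 // ((pcharf0P K).1 charK) -lt0n muln_gt0.
by rewrite multinom_gt0 prodn_gt0 // => i; exact: fact_gt0.
Qed.
End Potential.

Theorem theorem1p9 (F : closedFieldType) (charF0 : [pchar F] =i pred0)
  (d k : nat) (hk : (2 <= k)%N) (hkd : (k < d)%N) :
  exists B : rat, forall (n m : nat), (0 < n)%N -> (0 < m)%N ->
    forall phi : {linear Pol F n d -> Ten F m k},
      (exists p : Pol F n d, phi p != 0) ->
      Pot phi <= B * (n ^ ((k - 1) * d %/ k))%:R.
Proof.
(* The constant counts the assignments of [d] letters to [k] factors. *)
exists (k ^ d)%:R => n m n0 m0 phi _.
have k0 : (0 < k)%N by exact: leq_trans hk.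
have he : ((k - 1) * d < k * ((k - 1) * d %/ k).+1)%N.
  by rewrite mulnC -[in X in (_ < X)%N]mulnC ltn_ceil.
set e := (_ %/ _)%N in he *.
have [_ simple_le] := mu_maxP phi (@lin_pow F n d) (fun=> 0) k0.
have [[p pE] _] := mu_maxP phi (@id (Pol F n d)) 0 k0.
rewrite /Pot -pE.
set r := mu_max _ (@lin_pow F n d) in simple_le *.
have rphi c : sum_of_pure (phi (lin_pow d c)) r.
  by apply: (sum_of_pure_mono k0 (simple_le c)); case: (trkP (phi (lin_pow d c)) k0).
have := (trkP (phi p) k0).2 _ (sum_of_pure_linear charF0 k0 n0 p he rphi).
(* For [r = 0] the quotient is 0, by the convention that 0 has inverse 0. *)
move=> le; have [r0|r0] := posnP r.
  by rewrite r0 invr0 mulr0 -natrM ler0n.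
rewrite ler_pdivrMr ?ltr0n // -!natrM ler_nat.
by rewrite mulnC mulnA.
Qed.
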